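(* Let $f$ and $h$ be nonzero elements of $\mathcal F$. Then for all $\alpha\in\ker(f\circ h)$ and $\beta\in\ker f^\ast\subseteq\ker(f\circ h)^\ast$, $\langle\alpha,\beta\rangle_{f\circ h}=\langle h(\alpha),\beta\rangle_f$. Similarly, for all $\alpha\in\ker f\subseteq\ker(h\circ f)$ and $\beta\in\ker(h\circ f)^\ast$, $\langle\alpha,\beta\rangle_{h\circ f}=\langle\alpha,h^\ast(\beta)\rangle_f$.
   Context: Let $p$ be a prime, $q$ a power of $p$, and $C$ an algebraically closed field containing $\mathbb F_q$, complete with respect to a non-archimedean absolute value. $\mathcal F$ is the set of formal sums $f=\sum_{n\in\mathbb Z}a_n\tau^n$ ($a_n\in C$) such that $f(z)=\sum_na_nz^{q^n}$ converges for all $z\in C$; it is a ring (without zero divisors) under termwise addition and composition $(\sum a_i\tau^i)\circ(\sum b_j\tau^j)=\sum_n(\sum_{i+j=n}a_ib_j^{q^i})\tau^n$ (composition of maps), with $c\in C$ identified with multiplication by $c$. $\ker f=\{z\in C:f(z)=0\}$. The adjoint is $f^\ast=\sum_na_n^{1/q^n}\tau^{-n}$, and $(f\circ g)^\ast=g^\ast\circ f^\ast$. For nonzero $f$ and $\alpha\in\ker f$, $g_\alpha\in\mathcal F$ is the unique element with $f\circ\alpha=g_\alpha\circ(1-\tau)$, and $\langle\alpha,\beta\rangle_f=g_\alpha^\ast(\beta)\in\mathbb F_q$ for $\beta\in\ker f^\ast$. *)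

(* Defs.v *)
From HB Require Import structures.
From mathcomp Require Import all_boot all_order all_algebra.
From mathcomp Require Import all_classical all_reals all_analysis.
Set Implicit Arguments.
Unset Strict Implicit.
Unset Printing Implicit Defensive.
Import Order.TTheory GRing.Theory Num.Theory.
Import numFieldNormedType.Exports.
Local Open Scope classical_set_scope.
Local Open Scope ring_scope.

Record nonarch_abs (R : realType) (C : fieldType) (v : C -> R) : Prop :=
  NonarchAbs {
    nonarch_abs_ge0 : forall x, 0 <= v x;
    nonarch_abs_eq0 : forall x, v x = 0 <-> x = 0;
    nonarch_absM : forall x y, v (x * y) = v x * v y;
    nonarch_absD : forall x y, v (x + y) <= Num.max (v x) (v y) }.

Definition abs_complete (R : realType) (C : fieldType) (v : C -> R) : Prop :=
  forall u : nat -> C,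
    (forall e : R, 0 < e ->
       exists N : nat, forall m n : nat,
         (N <= m)%N -> (N <= n)%N -> v (u m - u n) < e) ->
    exists l : C, v (u n - l) @[n --> \oo] --> (0 : R).

(* The formal sum \sum_n a_n tau^n is represented by n |-> a_n; the ring F
   consists of those satisfying everywhere_convergent below. *)
Definition tau_series (C : fieldType) := int -> C.

(* x ^ (q ^ n) for n in Z. For n < 0 this is the q^|n|-th root of x, which
   exists and is unique when C is an algebraically closed field of
   characteristic p and q is a power of p; it is a junk value otherwise. *)
Definition frobz (C : fieldType) (q : nat) (n : int) (x : C) : C :=
  match n with
  | Posz k => x ^+ (q ^ k)
  | Negz k => xget 0 [set y : C | y ^+ (q ^ k.+1) = x]
  end.

(* Doubly infinite series: the partial sums over [-N.2, N.1 - 1] converge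
   to s as N.1 and N.2 tend to infinity independently. *)
Definition zsum_to (R : realType) (C : fieldType) (v : C -> R)
    (u : int -> C) (s : C) : Prop :=
  v (\sum_(i < N.1) u (Posz i) + \sum_(i < N.2) u (Negz i) - s)
    @[N --> filter_prod \oo \oo] --> (0 : R).

Definition zsum (R : realType) (C : fieldType) (v : C -> R)
    (u : int -> C) : C :=
  xget 0 [set s : C | zsum_to v u s].

Section TauSeries.
Context (R : realType) (C : fieldType) (v : C -> R) (q : nat).
Implicit Types f g : tau_series C.

Definition everywhere_convergent f : Prop :=
  forall z : C, exists s : C, zsum_to v (fun n => f n * frobz q n z) s.

Definition tau_eval f (z : C) : C := zsum v (fun n => f n * frobz q n z).

Definition tau_ker f : set C := [set z | tau_eval f z = 0].

Definition tau_comp f g : tau_series C :=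
  fun n => zsum v (fun i => f i * frobz q i (g (n - i))).

Definition tau_const (c : C) : tau_series C := fun n => if n == 0 then c else 0.

Definition tau : tau_series C := fun n => if n == 1 then 1 else 0.

Definition one_sub_tau : tau_series C := fun n => tau_const 1 n - tau n.

(* The coefficient of tau^n in \sum_m a_m^(1/q^m) tau^(-m) is
   a_(-n)^(q^n). *)
Definition tau_adjoint f : tau_series C := fun n => frobz q n (f (- n)).

(* The element g_alpha with f o alpha = g_alpha o (1 - tau); it exists and is
   unique when f is everywhere convergent and alpha is in ker f. *)
Definition tau_quotient f (alpha : C) : tau_series C :=
  xget (fun=> 0) [set g | everywhere_convergent g /\
                          tau_comp f (tau_const alpha) = tau_comp g one_sub_tau].

Definition tau_pairing f (alpha beta : C) : C :=
  tau_eval (tau_adjoint (tau_quotient f alpha)) beta.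

End TauSeries.

(* Main.v *)
Require Import Defs.
From HB Require Import structures.
From mathcomp Require Import all_boot all_order all_algebra finfield ring zify.
From mathcomp Require Import all_classical all_reals all_analysis.
Set Implicit Arguments.
Unset Strict Implicit.
Unset Printing Implicit Defensive.
Import Order.TTheory GRing.Theory Num.Theory.
Import numFieldNormedType.Exports.
Local Open Scope classical_set_scope.
Local Open Scope ring_scope.

(** Write [g_(f,alpha)] for the element with
    [f o alpha = g_(f,alpha) o (1 - tau)].  An element [k] of the ring is right
    divisible by [1 - tau] exactly when [k(1) = 0], and the quotient is unique.
    As [h o alpha - h(alpha)] vanishes at [1], it equals [k o (1 - tau)], whence
    [g_(f o h,alpha) = g_(f,h(alpha)) + f o k]; the adjoint of the second term is
    [k^* o f^*], which kills [ker f^*].  On the other side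
    [g_(h o f,alpha) = h o g_(f,alpha)].

    Evaluating a composite is a double series, which may be summed in either
    order because, by the ultrametric inequality, a family whose terms tend to 0
    along the finite subsets of the index set is unconditionally summable. *)

(** * Ultrametric absolute values and unconditional sums *)

Section UltrametricSums.
Context (R : realType) (C : fieldType) (v : C -> R) (v_abs : nonarch_abs v).

Lemma nonarch_abs0 : v 0 = 0.
Proof. exact/(nonarch_abs_eq0 v_abs). Qed.

Lemma nonarch_abs_gt0 x : x != 0 -> 0 < v x.
Proof.
move=> x_neq0; rewrite lt_def (nonarch_abs_ge0 v_abs) andbT.
by apply: contra x_neq0 => /eqP/(nonarch_abs_eq0 v_abs) ->.
Qed.

Lemma nonarch_abs1 : v 1 = 1.
Proof.
apply: (mulfI (lt0r_neq0 (nonarch_abs_gt0 (oner_neq0 C)))).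
by rewrite -(nonarch_absM v_abs) !mulr1.
Qed.

Lemma nonarch_absX x n : v (x ^+ n) = v x ^+ n.
Proof.
elim: n => [|n IHn]; first by rewrite !expr0 nonarch_abs1.
by rewrite !exprS (nonarch_absM v_abs) IHn.
Qed.

Lemma nonarch_absN x : v (- x) = v x.
Proof.
have v_sq : v (-1) ^+ 2 = 1 by rewrite -nonarch_absX sqrrN expr1n nonarch_abs1.
have vN1 : v (-1) = 1.
  by apply/eqP; rewrite -(@eqrXn2 _ 2) // ?(nonarch_abs_ge0 v_abs) // v_sq expr1n.
by rewrite -mulN1r (nonarch_absM v_abs) vN1 mul1r.
Qed.

Lemma nonarch_absV x : v x^-1 = (v x)^-1.
Proof.
have [->|x_neq0] := eqVneq x 0; first by rewrite invr0 nonarch_abs0 invr0.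
apply: (mulfI (lt0r_neq0 (nonarch_abs_gt0 x_neq0))).
by rewrite -(nonarch_absM v_abs) divff // nonarch_abs1 divff // lt0r_neq0 //
  nonarch_abs_gt0.
Qed.

Lemma nonarch_absD_lt eps x y : v x < eps -> v y < eps -> v (x + y) < eps.
Proof.
move=> vx vy; apply: le_lt_trans (nonarch_absD v_abs x y) _.
by rewrite gt_max vx.
Qed.

Lemma nonarch_absB_lt eps x y : v x < eps -> v y < eps -> v (x - y) < eps.
Proof. by move=> vx vy; apply: nonarch_absD_lt; rewrite ?nonarch_absN. Qed.

Lemma nonarch_abs_sum_lt (I : Type) (r : seq I) (P : pred I) (u : I -> C) eps :
  0 < eps -> (forall i, P i -> v (u i) < eps) ->
  v (\sum_(i <- r | P i) u i) < eps.
Proof.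
move=> eps_gt0 u_lt; apply: (big_ind (fun x => v x < eps)) => //.
  by rewrite nonarch_abs0.
by move=> x y; apply: nonarch_absD_lt.
Qed.

Lemma nonarch_abs_small_eq0 x : (forall eps, 0 < eps -> v x < eps) -> x = 0.
Proof.
move=> x_small; apply/(nonarch_abs_eq0 v_abs)/eqP.
case: ltgtP (nonarch_abs_ge0 v_abs x) => // vx_gt0 _.
by have := x_small _ vx_gt0; rewrite ltxx.
Qed.

Definition abs_null (I : eqType) (u : I -> C) : Prop :=
  forall eps : R, 0 < eps ->
    exists A : seq I, forall i, i \notin A -> v (u i) < eps.

(* By the ultrametric inequality a single finite set with small tail decides
   the sum up to eps, so no quantification over larger finite sets is needed. *)
Definition abs_sum (I : eqType) (u : I -> C) (s : C) : Prop :=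
  forall eps : R, 0 < eps ->
    exists A : seq I, [/\ uniq A, forall i, i \notin A -> v (u i) < eps
                        & v (\sum_(i <- A) u i - s) < eps].

Section EqIndex.
Context (I : eqType).
Implicit Types (u w : I -> C) (A B : seq I).

(** The terms over the common part of [A] and [B] cancel; every remaining term lies outside [A] or
    outside [B] and is therefore small. *)
Lemma big_seq_sub_lt u A B eps :
  0 < eps -> uniq A -> uniq B ->
  (forall i, i \notin A -> v (u i) < eps) ->
  (forall i, i \notin B -> v (u i) < eps) ->
  v (\sum_(i <- A) u i - \sum_(i <- B) u i) < eps.
Proof.
move=> eps_gt0 A_uniq B_uniq A_tail B_tail.
rewrite (bigID (mem B)) [X in _ - X](bigID (mem A)) /=.
have -> : \sum_(i <- B | i \in A) u i = \sum_(i <- A | i \in B) u i.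
  rewrite -big_filter -[RHS]big_filter; apply: perm_big.
  apply: uniq_perm; rewrite ?filter_uniq // => i.
  by rewrite !mem_filter andbC.
by rewrite opprD addrACA subrr add0r; apply: nonarch_absB_lt;
  apply: nonarch_abs_sum_lt.
Qed.

Lemma abs_sum_null u s : abs_sum u s -> abs_null u.
Proof. by move=> us eps /us[A [_ A_tail _]]; exists A. Qed.

Lemma abs_sum_tail u s B eps :
  abs_sum u s -> 0 < eps -> uniq B -> (forall i, i \notin B -> v (u i) < eps) ->
  v (\sum_(i <- B) u i - s) < eps.
Proof.
move=> us eps_gt0 B_uniq B_tail; have [A [A_uniq A_tail As]] := us _ eps_gt0.
rewrite -(subrK (\sum_(i <- A) u i) (\sum_(i <- B) u i)) -addrA.
by apply: nonarch_absD_lt => //; apply: big_seq_sub_lt.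
Qed.

Lemma abs_sum_unique u s t : abs_sum u s -> abs_sum u t -> s = t.
Proof.
move=> us ut; apply/eqP; rewrite -subr_eq0; apply/eqP/nonarch_abs_small_eq0.
move=> eps eps_gt0; have [A [A_uniq A_tail As]] := us _ eps_gt0.
have At := abs_sum_tail ut eps_gt0 A_uniq A_tail.
by have := nonarch_absB_lt At As; rewrite opprB addrC addrA subrK.
Qed.

(** The empty index set already has a small tail, so its sum 0 approximates [s]. *)
Lemma abs_sum_lt u s eps :
  abs_sum u s -> 0 < eps -> (forall i, v (u i) < eps) -> v s < eps.
Proof.
move=> us eps_gt0 u_lt.
have := @abs_sum_tail u s [::] eps us eps_gt0 isT (fun i _ => u_lt i).
by rewrite big_nil sub0r nonarch_absN.
Qed.

Lemma abs_sum_finite u A :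
  uniq A -> (forall i, i \notin A -> u i = 0) -> abs_sum u (\sum_(i <- A) u i).
Proof.
move=> A_uniq A_supp eps eps_gt0; exists A; split=> // [i /A_supp ->|].
  by rewrite nonarch_abs0.
by rewrite subrr nonarch_abs0.
Qed.

Lemma abs_sumD u w s t :
  abs_sum u s -> abs_sum w t -> abs_sum (fun i => u i + w i) (s + t).
Proof.
move=> us wt eps eps_gt0.
have [A A_tail] := abs_sum_null us eps_gt0.
have [B B_tail] := abs_sum_null wt eps_gt0.
have AB_tail i : i \notin undup (A ++ B) -> v (u i) < eps /\ v (w i) < eps.
  rewrite mem_undup mem_cat negb_or => /andP[iA iB].
  by split; [exact: A_tail|exact: B_tail].
exists (undup (A ++ B)); split; first exact: undup_uniq.
  by move=> i /AB_tail[]; apply: nonarch_absD_lt.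
rewrite big_split opprD addrACA; apply: nonarch_absD_lt;
  by apply: abs_sum_tail; rewrite ?undup_uniq // => i /AB_tail[].
Qed.

(** Additivity reduces continuity of [phi] to continuity at 0. The maps in view are
    [x => a * x^(q^n)], which may thus be applied termwise. *)
Lemma abs_sum_morph (phi : C -> C) u s :
  {morph phi : x y / x + y} ->
  (forall eps, 0 < eps ->
     exists2 delta, 0 < delta & forall x, v x < delta -> v (phi x) < eps) ->
  abs_sum u s -> abs_sum (phi \o u) (phi s).
Proof.
move=> phiD phi_cont us eps /phi_cont[delta /us[A [A_uniq A_tail As]] phi_lt].
have phi0 : phi 0 = 0 by apply: (addrI (phi 0)); rewrite -phiD !addr0.
have phiN x : phi (- x) = - phi x.
  by apply: (addrI (phi x)); rewrite -phiD !subrr.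
exists A; split=> // [i /A_tail/phi_lt//|].
by rewrite -(big_morph _ phiD phi0) -phiN -phiD; apply: phi_lt.
Qed.

Lemma abs_sum_reindex (J : eqType) (k : J -> I) (k' : I -> J) u s :
  cancel k k' -> cancel k' k -> abs_sum u s -> abs_sum (u \o k) s.
Proof.
move=> kK k'K us eps /us[A [A_uniq A_tail As]].
exists (map k' A); split; first by rewrite map_inj_uniq //; apply: can_inj k'K.
  by move=> j jA; apply: A_tail; apply: contra jA => /(map_f k'); rewrite kK.
by rewrite big_map; under eq_bigr do rewrite /= k'K.
Qed.

Lemma abs_null_reindex (J : eqType) (k : J -> I) (k' : I -> J) u :
  cancel k k' -> abs_null u -> abs_null (u \o k).
Proof.
move=> kK u_null eps /u_null[A A_tail]; exists (map k' A) => j jA.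
by apply: A_tail; apply: contra jA => /(map_f k'); rewrite kK.
Qed.

Lemma abs_null_le u w :
  (forall i, v (u i) <= v (w i)) -> abs_null w -> abs_null u.
Proof.
move=> uw w_null eps /w_null[A A_tail]; exists A => i /A_tail.
exact: le_lt_trans.
Qed.

Lemma abs_null_scale c u : abs_null u -> abs_null (fun i => c * u i).
Proof.
have [-> _|c_neq0 u_null] := eqVneq c 0.
  by move=> eps eps_gt0; exists [::] => i _; rewrite mul0r nonarch_abs0.
have vc_gt0 := nonarch_abs_gt0 c_neq0.
move=> eps eps_gt0; have [A A_tail] := u_null _ (divr_gt0 eps_gt0 vc_gt0).
exists A => i /A_tail; rewrite ltr_pdivlMr // => u_lt.
by rewrite (nonarch_absM v_abs) mulrC.
Qed.

Lemma abs_nullD u w :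
  abs_null u -> abs_null w -> abs_null (fun i => u i + w i).
Proof.
move=> u_null w_null eps eps_gt0.
have [A A_tail] := u_null _ eps_gt0; have [B B_tail] := w_null _ eps_gt0.
exists (A ++ B) => i; rewrite mem_cat negb_or => /andP[/A_tail ? /B_tail ?].
exact: nonarch_absD_lt.
Qed.

(* The maximum is attained, so the bound is the absolute value of an element
   of C at which an everywhere convergent series may be evaluated. *)
Lemma abs_null_bounded u : abs_null u -> exists c, forall i, v (u i) <= v c.
Proof.
move=> /(_ 1 ltr01)[A A_tail].
suff [c [c_ge1 c_bound]] : exists c, 1 <= v c /\ {in A, forall i, v (u i) <= v c}.
  exists c => i; have [/c_bound //|/A_tail/ltW u_le1] := boolP (i \in A).
  exact: le_trans c_ge1.
elim: A {A_tail} => [|i A [c [c_ge1 c_bound]]].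
  by exists 1; rewrite nonarch_abs1.
have [ui_le|c_lt] := leP (v (u i)) (v c).
  by exists c; split=> // j; rewrite inE => /predU1P[->|/c_bound].
exists (u i); split; first by apply: le_trans c_ge1 _; apply: ltW.
move=> j; rewrite inE => /predU1P[->//|/c_bound] /le_trans; apply.
exact: ltW.
Qed.

(** Finite sets with tails below [1/(n+1)] have partial sums that form a Cauchy sequence by
    [big_seq_sub_lt]; its limit is the sum. *)
Lemma abs_null_summable u : abs_complete v -> abs_null u -> exists s, abs_sum u s.
Proof.
move=> v_complete u_null.
have A_ex (n : nat) : exists A : seq I,
    forall i, i \notin A -> v (u i) < n.+1%:R^-1.
  by apply: u_null; rewrite invr_gt0.
have [A A_tail] := choice A_ex.
have inv_small (eps : R) : 0 < eps ->
    exists N : nat, forall n, (N <= n)%N -> n.+1%:R^-1 < eps.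
  move=> eps_gt0; exists (Num.truncn eps^-1) => n Nn.
  rewrite -[ltRHS]invrK ltf_pV2 ?posrE ?invr_gt0 //.
  have /truncn_itv/andP[_ /lt_le_trans] : 0 <= eps^-1 by rewrite invr_ge0 ltW.
  by apply; rewrite ler_nat.
have tail_le n (eps : R) i :
    n.+1%:R^-1 < eps -> i \notin undup (A n) -> v (u i) < eps.
  by rewrite mem_undup => n_lt /A_tail/lt_trans; apply.
pose S n := \sum_(i <- undup (A n)) u i.
have [|l S_l] := v_complete S.
  move=> eps eps_gt0; have [N N_lt] := inv_small _ eps_gt0.
  exists N => m n /N_lt m_lt /N_lt n_lt.
  by apply: big_seq_sub_lt; rewrite ?undup_uniq // => i; apply: tail_le.
exists l => eps eps_gt0; have [N N_lt] := inv_small _ eps_gt0.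
have [M _ M_lt] := (iffLR (cvgr0Pnorm_lt _)) S_l _ eps_gt0.
(* An index at least [N] makes the tail small, an index at least [M] the distance from the partial
   sum to [l]. *)
exists (undup (A (maxn N M))); split; first exact: undup_uniq.
  by move=> i; apply: tail_le; apply: N_lt; apply: leq_maxl.
apply: le_lt_trans (ler_norm _) _; apply: M_lt => /=; apply: leq_maxr.
Qed.

End EqIndex.

(** Take finitely many rows, each cut to a finite set with small tail: the errors of the row sums do
    not accumulate, by the ultrametric inequality. *)
Lemma abs_sum_pair (I J : eqType) (u : I -> J -> C) (t : I -> C) s :
  abs_null (fun p : I * J => u p.1 p.2) ->
  (forall i, abs_sum (u i) (t i)) -> abs_sum t s ->
  abs_sum (fun p : I * J => u p.1 p.2) s.
Proof.
move=> u_null ut ts eps eps_gt0.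
have [A A_tail] := u_null _ eps_gt0.
have [I0 I0_tail] := abs_sum_null ts eps_gt0.
have [J0 J0_tail] := choice (fun i => abs_sum_null (ut i) eps_gt0).
(* Adjoining the projections of [A] makes [L] contain [A], while [I0] and [J0 i] keep the tails of
   [t] and of row [i] small. *)
pose I1 := undup (I0 ++ map fst A); pose J1 i := undup (J0 i ++ map snd A).
pose L := [seq (i, j) | i <- I1, j <- J1 i].
have AL p : p \in A -> p \in L.
  move=> pA; apply/allpairsPdep; exists p.1, p.2.
  rewrite !mem_undup !mem_cat (map_f fst pA) (map_f snd pA) !orbT.
  by split=> //; case: p {pA}.
exists L; split.
- apply: allpairs_uniq_dep; rewrite ?undup_uniq //.
    by move=> i _; apply: undup_uniq.
  by move=> [i j] [i' j'] _ _ /= [-> ->].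
- by move=> p pL; apply: A_tail; apply: contra pL; apply: AL.
rewrite big_allpairs_dep /=.
rewrite -(subrK (\sum_(i <- I1) t i) (\sum_(i <- I1) _)) -addrA.
apply: nonarch_absD_lt.
  rewrite -sumrB; apply: nonarch_abs_sum_lt => // i _.
  apply: abs_sum_tail (ut i) eps_gt0 (undup_uniq _) _ => j.
  by rewrite mem_undup mem_cat negb_or => /andP[/J0_tail].
apply: abs_sum_tail ts eps_gt0 (undup_uniq _) _ => i.
by rewrite mem_undup mem_cat negb_or => /andP[/I0_tail].
Qed.

(** * Doubly infinite series, with partial sums over the integers in [[-n, m-1]] *)

Definition int_box (m n : nat) : seq int :=
  map Posz (iota 0 m) ++ map Negz (iota 0 n).

Lemma mem_int_boxP m n (i : nat) : (Posz i \in int_box m n) = (i < m)%N.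
Proof.
rewrite mem_cat mem_map ?mem_iota /= => [|a b []//].
rewrite (_ : (Posz i \in map Negz _) = false) ?orbF //.
by apply/negP => /mapP[].
Qed.

Lemma mem_int_boxN m n (i : nat) : (Negz i \in int_box m n) = (i < n)%N.
Proof.
rewrite mem_cat orbC mem_map ?mem_iota /= => [|a b []//].
rewrite (_ : (Negz i \in map Posz _) = false) ?orbF //.
by apply/negP => /mapP[].
Qed.

Lemma int_box_uniq m n : uniq (int_box m n).
Proof.
rewrite cat_uniq !map_inj_uniq ?iota_uniq //= => [|a b []//|a b []//].
by rewrite andbT; apply/hasPn => _ /mapP[i _ ->]; apply/negP => /mapP[].
Qed.

Lemma big_int_box m n (u : int -> C) :
  \sum_(i <- int_box m n) u i = \sum_(i < m) u (Posz i) + \sum_(i < n) u (Negz i).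
Proof.
rewrite big_cat !big_map /= -(big_mkord xpredT (fun i => u (Posz i))).
by rewrite -(big_mkord xpredT (fun i => u (Negz i))) /index_iota !subn0.
Qed.

Lemma int_box_exhaust (A : seq int) :
  exists N : nat, forall m n, (N <= m)%N -> (N <= n)%N -> {subset A <= int_box m n}.
Proof.
elim: A => [|i A [N N_sub]]; first by exists 0%N.
exists (maxn N `|i|.+1) => m n; rewrite !geq_max => /andP[Nm im] /andP[Nn im'].
move=> j; rewrite inE => /predU1P[->|/N_sub]; last exact.
by case: i im im' => k /=; rewrite ?mem_int_boxP ?mem_int_boxN // => _ /ltnW.
Qed.

(** From left to right, a term outside a large box is the difference of two partial sums whose boxes
    differ by that one index. From right to left, every large box contains the finite exceptional
    set. *)
Lemma zsum_toP (u : int -> C) s : zsum_to v u s <-> abs_sum u s.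
Proof.
split=> [us eps eps_gt0|us].
  have /= [[P Q] [/= [M _ MP] [N _ NQ]] PQ] :=
    (iffLR (cvgr0Pnorm_lt _)) us _ eps_gt0.
  have box_lt m n : (maxn M N <= m)%N -> (maxn M N <= n)%N ->
      v (\sum_(i <- int_box m n) u i - s) < eps.
    rewrite !geq_max => /andP[Mm _] /andP[_ Nn]; rewrite big_int_box.
    by apply: le_lt_trans (ler_norm _) _; apply: (PQ (m, n)); split;
      [exact: MP|exact: NQ].
  set K := maxn M N in box_lt.
  exists (int_box K K); split; [exact: int_box_uniq| |exact: box_lt].
  case=> i; rewrite ?mem_int_boxP ?mem_int_boxN -leqNgt => Ki.
    have := nonarch_absB_lt (box_lt _ _ (leqW Ki) (leqnn K)) (box_lt _ _ Ki (leqnn K)).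
    rewrite !big_int_box big_ord_recr /= => lt_eps; congr (v _ < _): lt_eps.
    ring.
  have := nonarch_absB_lt (box_lt _ _ (leqnn K) (leqW Ki)) (box_lt _ _ (leqnn K) Ki).
  rewrite !big_int_box big_ord_recr /= => lt_eps; congr (v _ < _): lt_eps.
  ring.
apply/cvgr0Pnorm_lt => eps eps_gt0; have [A A_tail] := abs_sum_null us eps_gt0.
have [N N_sub] := int_box_exhaust A.
exists ([set n | (N <= n)%N], [set n | (N <= n)%N]).
  by split; apply: nbhs_infty_ge.
move=> [m n] [/= Nm Nn]; rewrite ger0_norm ?(nonarch_abs_ge0 v_abs) // -big_int_box.
apply: abs_sum_tail us eps_gt0 (int_box_uniq _ _) _ => i iB.
by apply: A_tail; apply: contra iB; apply: N_sub.
Qed.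

Lemma zsum_eq (u : int -> C) s : abs_sum u s -> zsum v u = s.
Proof.
move=> us; apply: xget_unique; first exact/zsum_toP.
by move=> t /zsum_toP ut; apply: abs_sum_unique ut us.
Qed.

End UltrametricSums.

(** * The powers [x^(q^n)] for integers [n] *)

Section Frobenius.
Context (R : realType) (C : closedFieldType) (v : C -> R) (v_abs : nonarch_abs v).
Context (q : nat) (q_pchar : [pchar C].-nat q).

Local Notation phi := (@frobz C q).

Let qX_pchar n : [pchar C].-nat (q ^ n)%N.
Proof. by rewrite pnatX q_pchar. Qed.

Let qX_gt0 n : (0 < q ^ n)%N.
Proof. by rewrite expn_gt0; case/andP: q_pchar => ->. Qed.

(** The power map is additive by the hypothesis on [q], and a field has no nilpotents. Identities
    for [frobz] are proved below by raising both sides to a power that clears the roots. *)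
Lemma exp_qX_inj n : injective (fun x : C => x ^+ (q ^ n)).
Proof.
move=> x y /= xy; apply/eqP; rewrite -subr_eq0.
have /eqP : (x - y) ^+ (q ^ n) = 0.
  by apply: (addIr (y ^+ (q ^ n))); rewrite -exprDn_pchar // subrK xy add0r.
by rewrite expf_eq0 => /andP[].
Qed.

(** Algebraic closedness gives a root of [X^(q^(k+1)) - x], so [xget] does not fall back on its
    default 0. *)
Lemma frobz_Negz k x : phi (Negz k) x ^+ (q ^ k.+1) = x.
Proof.
have [y y_root] := solve_monicpoly
  (fun i => if i == 0%N then x else 0) (qX_gt0 k.+1).
rewrite /frobz; case: xgetP => [z _ //|/(_ y) []]; rewrite /= y_root.
case: (q ^ k.+1)%N (qX_gt0 k.+1) => // d _.
by rewrite big_ord_recl /= expr0 mulr1 big1 ?addr0 // => i _; rewrite mul0r.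
Qed.

Lemma frobz_exp n N x :
  0 <= n + N%:Z -> phi n x ^+ (q ^ N) = x ^+ (q ^ `|n + N%:Z|).
Proof.
case: n => k; first by move=> _; rewrite /= -exprM -expnD.
move=> kN; have [d ->] : exists d, N = (k.+1 + d)%N by exists (N - k.+1)%N; lia.
rewrite expnD exprM frobz_Negz; congr (_ ^+ (q ^ _)); lia.
Qed.

Lemma frobz_exp_abs n x : phi n x ^+ (q ^ `|n|) = x ^+ (q ^ `|n + `|n|%:Z|).
Proof. by rewrite frobz_exp //; lia. Qed.

Lemma frobz_id x : phi 0 x = x.
Proof. by rewrite /= expn0 expr1. Qed.

Lemma frobz_comp m n x : phi m (phi n x) = phi (m + n) x.
Proof.
apply: (@exp_qX_inj (`|m| + `|n|)%N); rewrite [RHS]frobz_exp; last lia.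
rewrite expnD exprM frobz_exp_abs exprAC frobz_exp_abs -exprM -expnD.
congr (_ ^+ (q ^ _)); lia.
Qed.

Lemma frobzD n : {morph phi n : x y / x + y}.
Proof.
move=> x y; apply: (@exp_qX_inj `|n|%N).
by rewrite frobz_exp_abs !exprDn_pchar // !frobz_exp_abs.
Qed.

Lemma frobzM n : {morph phi n : x y / x * y}.
Proof.
move=> x y; apply: (@exp_qX_inj `|n|%N).
by rewrite frobz_exp_abs !exprMn // !frobz_exp_abs.
Qed.

Lemma frobz0 n : phi n 0 = 0.
Proof. by apply: (addrI (phi n 0)); rewrite -frobzD !addr0. Qed.

Lemma frobz1 n : phi n 1 = 1.
Proof.
by apply: (@exp_qX_inj `|n|%N); rewrite frobz_exp_abs !expr1n.
Qed.

Lemma frobzN n x : phi n (- x) = - phi n x.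
Proof. by apply: (addrI (phi n x)); rewrite -frobzD !subrr frobz0. Qed.

Lemma frobz_abs_exp n x :
  v (phi n x) ^+ (q ^ `|n|) = v x ^+ (q ^ `|n + `|n|%:Z|).
Proof. by rewrite -!(nonarch_absX v_abs) frobz_exp_abs. Qed.

Let v_nneg x : v x \is Num.nneg.
Proof. exact: nonarch_abs_ge0. Qed.

Lemma frobz_abs_le n x y : (v (phi n x) <= v (phi n y)) = (v x <= v y).
Proof.
by rewrite -(ler_pXn2r (qX_gt0 `|n|)) // !frobz_abs_exp ler_pXn2r.
Qed.

Lemma frobz_abs_lt n x y : (v (phi n x) < v (phi n y)) = (v x < v y).
Proof. by rewrite !ltNge frobz_abs_le. Qed.

Lemma frobz_abs_cont n eps : 0 < eps ->
  exists2 delta, 0 < delta & forall x, v x < delta -> v (phi n x) < eps.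
Proof.
(* For [v x < 1] one has [v (phi n x)^(q^|n|) = (v x)^(q^(n+|n|)) <= v x], the exponent being at
   least 1; this is compared with the [q^|n|]-th power of [eps]. *)
move=> eps_gt0; exists (Num.min 1 (eps ^+ (q ^ `|n|))).
  by rewrite lt_min ltr01 exprn_gt0.
move=> x; rewrite lt_min => /andP[x_lt1 x_lt].
rewrite -(ltr_pXn2r (qX_gt0 `|n|)) ?frobz_abs_exp //; last exact: ltW.
apply: le_lt_trans x_lt; rewrite -[leRHS]expr1.
by apply: ler_wiXn2l; rewrite ?(nonarch_abs_ge0 v_abs) // ltW.
Qed.

Lemma frobz_abs_ge1_homo m n c : 1 <= v c -> m <= n -> v (phi m c) <= v (phi n c).
Proof.
move=> c_ge1 mn; rewrite -[n](subrK m) addrC -frobz_comp frobz_abs_le.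
have [k ->] : exists k, n - m = Posz k by exists `|n - m|%N; lia.
by rewrite /= (nonarch_absX v_abs) ler_eXnr.
Qed.

Lemma frobz_abs_le1 k x : v x <= 1 -> v (phi (Posz k) x) <= v x.
Proof.
move=> x_le1; rewrite /= (nonarch_absX v_abs) -[leRHS]expr1.
by apply: ler_wiXn2l; rewrite ?(nonarch_abs_ge0 v_abs).
Qed.

Lemma frobz_abs_lt1 n x : (v (phi n x) < 1) = (v x < 1).
Proof. by rewrite -(nonarch_abs1 v_abs) -{1}(frobz1 n) frobz_abs_lt. Qed.

End Frobenius.

(** * Evaluation, composition and adjoint of everywhere convergent series *)

Section TauSeriesRing.
Context (R : realType) (C : closedFieldType) (v : C -> R) (v_abs : nonarch_abs v).
Context (v_complete : abs_complete v).
Context (q : nat) (q_pchar : [pchar C].-nat q).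
Implicit Types f g h k : tau_series C.

Local Notation phi := (@frobz C q).
Local Notation conv := (everywhere_convergent v q).
Local Notation eval := (tau_eval v q).
Local Notation "f \oT g" := (tau_comp v q f g) (at level 40).
Local Notation adj := (tau_adjoint q).

(** By completeness an ultrametric series converges once its terms tend to 0, so membership in the
    ring becomes a condition on the size of the terms. *)
Lemma everywhere_convergentP f :
  conv f <-> forall z, abs_null v (fun n => f n * phi n z).
Proof.
split=> f_conv z; first by have [s /(zsum_toP v_abs)/abs_sum_null] := f_conv z.
have [s fs] := abs_null_summable v_abs v_complete (f_conv z).
by exists s; apply/zsum_toP.
Qed.

Lemma everywhere_convergent_null f : conv f -> abs_null v f.
Proof.
move=> /everywhere_convergentP/(_ 1).
by apply: abs_null_le => n; rewrite frobz1 // mulr1.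
Qed.

Lemma tau_evalP f z : conv f -> abs_sum v (fun n => f n * phi n z) (eval f z).
Proof.
move=> /(_ z)[s fs]; move: (fs) => /(zsum_toP v_abs) fs'.
by rewrite /tau_eval (zsum_eq v_abs fs').
Qed.

Lemma tau_eval_eq f z s : abs_sum v (fun n => f n * phi n z) s -> eval f z = s.
Proof. exact: zsum_eq. Qed.

Lemma tau_eval0 f : eval f 0 = 0.
Proof.
apply: tau_eval_eq.
rewrite -[X in abs_sum _ _ X](big_nil 0 +%R xpredT (fun n => f n * phi n 0)).
by apply: abs_sum_finite => // n _; rewrite frobz0 // mulr0.
Qed.

Lemma scaled_frobz_morph n a : {morph (fun x => a * phi n x) : x y / x + y}.
Proof. by move=> x y; rewrite frobzD // mulrDr. Qed.

Lemma scaled_frobz_cont n a eps : 0 < eps ->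
  exists2 delta, 0 < delta & forall x, v x < delta -> v (a * phi n x) < eps.
Proof.
move=> eps_gt0; have [->|a_neq0] := eqVneq a 0.
  by exists 1 => // x _; rewrite mul0r nonarch_abs0.
have va_gt0 := nonarch_abs_gt0 v_abs a_neq0.
have [delta delta_gt0 delta_lt] :=
  frobz_abs_cont v_abs q_pchar n (divr_gt0 eps_gt0 va_gt0).
exists delta => // x /delta_lt; rewrite ltr_pdivlMr // => phix_lt.
by rewrite (nonarch_absM v_abs) mulrC.
Qed.

Lemma abs_sum_scaled_frobz (I : eqType) (u : I -> C) s n a :
  abs_sum v u s -> abs_sum v (fun i => a * phi n (u i)) (a * phi n s).
Proof.
exact: (abs_sum_morph (scaled_frobz_morph n a) (@scaled_frobz_cont n a)).
Qed.

Lemma abs_sum_scale (I : eqType) (u : I -> C) s a :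
  abs_sum v u s -> abs_sum v (fun i => a * u i) (a * s).
Proof.
move=> /(@abs_sum_scaled_frobz _ _ _ 0 a); rewrite frobz_id.
by under eq_fun do rewrite frobz_id.
Qed.

(** With [v c] bounding all terms of [g] at [z], convergence of [f] at [c] makes all but finitely
    many rows small uniformly in [j]; on each remaining row, continuity of [x => f i * x^(q^i)]
    leaves finitely many large terms. *)
Lemma tau_comp_null f g z : conv f -> conv g ->
  abs_null v (fun p : int * int => f p.1 * phi p.1 (g p.2 * phi p.2 z)).
Proof.
move=> /everywhere_convergentP f_conv /everywhere_convergentP g_conv.
have [c c_bound] := abs_null_bounded v_abs (g_conv z).
move=> eps eps_gt0; have [A A_tail] := f_conv c _ eps_gt0.
have row_tail i : exists B : seq int, forall j, j \notin B ->
    v (f i * phi i (g j * phi j z)) < eps.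
  have [delta delta_gt0 delta_lt] := scaled_frobz_cont i (f i) eps_gt0.
  by have [B B_tail] := g_conv z _ delta_gt0; exists B => j /B_tail/delta_lt.
have [B B_tail] := choice row_tail.
exists [seq (i, j) | i <- A, j <- B i] => -[i j] ijAB /=.
have [iA|/A_tail] := boolP (i \in A).
  apply: B_tail; apply: contra ijAB => jB; apply/allpairsPdep.
  by exists i, j.
apply: le_lt_trans; rewrite !(nonarch_absM v_abs (f i)).
by apply: ler_wpM2l; rewrite ?(nonarch_abs_ge0 v_abs) // frobz_abs_le.
Qed.

(** The terms form a subfamily of the double family at [z = 1], namely the antidiagonal
    [i + j = n]. *)
Lemma tau_compP f g n : conv f -> conv g ->
  abs_sum v (fun i => f i * phi i (g (n - i))) ((f \oT g) n).
Proof.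
move=> f_conv g_conv.
have fg_null := tau_comp_null 1 f_conv g_conv.
have [|s fgs] := @abs_null_summable _ _ _ v_abs _
  (fun i => f i * phi i (g (n - i))) v_complete.
  apply: abs_null_le (abs_null_reindex (k := fun i : int => (i, n - i))
    (k' := fst) _ fg_null) => //.
  by move=> i /=; rewrite (frobz1 q_pchar) mulr1.
by rewrite /tau_comp (zsum_eq v_abs fgs).
Qed.

Lemma tau_comp_eq f g n s :
  abs_sum v (fun i => f i * phi i (g (n - i))) s -> (f \oT g) n = s.
Proof. exact: zsum_eq. Qed.

(** Summed by rows, the double family [U] gives [f(g(z))]; after the shear [(n, i) -> (i, n - i)],
    summing over [i] first gives the terms of [f o g] at [z]. Unconditional sums are unique. *)
Lemma tau_comp_sum f g z : conv f -> conv g ->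
  abs_sum v (fun n => (f \oT g) n * phi n z) (eval f (eval g z)).
Proof.
move=> f_conv g_conv.
pose U (p : int * int) := f p.1 * phi p.1 (g p.2 * phi p.2 z).
have U_null : abs_null v U := tau_comp_null z f_conv g_conv.
have U_sum : abs_sum v U (eval f (eval g z)).
  pose u i j := f i * phi i (g j * phi j z).
  apply: (@abs_sum_pair _ _ _ v_abs _ _ u _ _ U_null _ (tau_evalP _ f_conv)) => i.
  exact: abs_sum_scaled_frobz (tau_evalP _ g_conv).
pose shear (p : int * int) := (p.2, p.1 - p.2).
pose unshear (p : int * int) := (p.1 + p.2, p.1).
have shearK : cancel shear unshear by case=> n i; rewrite /unshear /= addrC subrK.
have unshearK : cancel unshear shear.
  by case=> i j; rewrite /shear /= addrAC subrr add0r.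
pose W n i := f i * phi i (g (n - i)) * phi n z.
have UW : U \o shear = (fun p => W p.1 p.2).
  apply/funext => -[n i]; rewrite /U /W /= frobzM // frobz_comp //.
  by rewrite (addrC i) subrK mulrA.
have W_null := abs_null_reindex shearK U_null; rewrite UW in W_null.
have W_row n : abs_sum v (W n) ((f \oT g) n * phi n z).
  have := abs_sum_scale (phi n z) (tau_compP n f_conv g_conv).
  by rewrite mulrC; congr (abs_sum v _ _); apply/funext => i; rewrite mulrC.
have [|s fgs] := @abs_null_summable _ _ _ v_abs _
  (fun n => (f \oT g) n * phi n z) v_complete.
  (* A row that avoids [A] has only small terms, hence a small sum. *)
  move=> eps eps_gt0; have [A A_tail] := W_null _ eps_gt0.
  exists (map fst A) => n nA; apply: (abs_sum_lt v_abs (W_row n) eps_gt0) => i.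
  by apply: (A_tail (n, i)); apply: contra nA => /(map_f fst).
have W_sum := abs_sum_reindex shearK unshearK U_sum; rewrite UW in W_sum.
by rewrite (abs_sum_unique v_abs W_sum (abs_sum_pair v_abs W_null W_row fgs)).
Qed.

Lemma tau_comp_convergent f g : conv f -> conv g -> conv (f \oT g).
Proof.
move=> f_conv g_conv z; exists (eval f (eval g z)).
by apply/zsum_toP => //; apply: tau_comp_sum.
Qed.

Lemma tau_eval_comp f g z : conv f -> conv g ->
  eval (f \oT g) z = eval f (eval g z).
Proof. by move=> f_conv g_conv; apply/tau_eval_eq/tau_comp_sum. Qed.

(** The map [phi n] is additive and continuous, so it applies termwise to the coefficient of degree
    [-n] of [f o g]; the substitution [i = j - n] turns the result into the coefficient of degree
    [n] of [g^* o f^*]. *)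
Lemma tau_adjoint_comp f g : conv f -> conv g -> adj (f \oT g) = adj g \oT adj f.
Proof.
move=> f_conv g_conv; apply/funext => n; apply/esym/tau_comp_eq.
have /(abs_sum_scaled_frobz n 1) := tau_compP (- n) f_conv g_conv.
rewrite mul1r => fg_sum.
have := abs_sum_reindex (k := fun j : int => j - n) (addrNK n) (addrK n) fg_sum.
congr (abs_sum v _ _); apply/funext => j; rewrite /tau_adjoint /= mul1r.
rewrite frobzM // !frobz_comp // mulrC; congr (phi _ (g _) * phi _ (f _)); ring.
Qed.

(* Coefficients of negative degree only tend to 0, which their q^n-th powers
   do faster; those of positive degree decay faster than c^(q^n) for every c,
   which is what survives taking q^n-th roots.  When no nonzero element of C is
   smaller than eps, the latter coefficients eventually vanish. *)
Lemma tau_adjoint_convergent f : conv f -> conv (adj f).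
Proof.
move=> f_conv; apply/everywhere_convergentP => z eps eps_gt0.
(* The term of degree [-n] of the adjoint series at [z] is [phi (- n) (z * f n)]. *)
have zf_null := abs_null_scale v_abs z (everywhere_convergent_null f_conv).
have [A A_tail] : exists A : seq int, forall n, n \notin A ->
    v (z * f n) < Num.min 1 eps by apply: zf_null; rewrite lt_min ltr01.
have [B B_tail] : exists B : seq int, forall n : int, n \notin B -> 0 <= n ->
    v (phi (- n) (z * f n)) < eps.
  have [[c c_neq0 c_le]|no_c] := pselect (exists2 c, c != 0 & v c <= eps).
    (* The bound 1 is chosen because [phi (- n)] preserves [v x < 1]; it sends
       [z * f n * phi n c^-1] to [phi (- n) (z * f n) * c^-1]. *)
    move: f_conv => /everywhere_convergentP/(_ c^-1)/(abs_null_scale v_abs z).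
    move=> /(_ 1 ltr01)[B B_tail]; exists B => n /B_tail B_lt n_ge0.
    have vc_gt0 := nonarch_abs_gt0 v_abs c_neq0.
    apply: lt_le_trans c_le; move: B_lt.
    rewrite -(frobz_abs_lt1 v_abs q_pchar (- n)) mulrA frobzM // frobz_comp //.
    rewrite addNr frobz_id.
    by rewrite (nonarch_absM v_abs) (nonarch_absV v_abs) ltr_pdivrMr // mul1r.
  exists A => n /A_tail; rewrite lt_min => /andP[_ zf_lt] _.
  have [->|zf_neq0] := eqVneq (z * f n) 0; first by rewrite frobz0 // nonarch_abs0.
  by case: no_c; exists (z * f n) => //; apply: ltW.
exists (map -%R (A ++ B)) => n nAB; rewrite /tau_adjoint -frobzM // mulrC.
have : - n \notin A ++ B by apply: contra nAB => /(map_f -%R); rewrite opprK.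
rewrite mem_cat negb_or => /andP[/A_tail nA /B_tail nB].
move: nA; rewrite lt_min => /andP[n_lt1 n_lt].
case: n {nAB} nB n_lt1 n_lt => k nB n_lt1 n_lt.
  by apply: le_lt_trans n_lt; apply: frobz_abs_le1 => //; apply: ltW.
by rewrite opprK in nB; apply: nB; rewrite NegzE opprK.
Qed.

Lemma everywhere_convergentD f g : conv f -> conv g -> conv (fun n => f n + g n).
Proof.
move=> /everywhere_convergentP f_conv /everywhere_convergentP g_conv.
apply/everywhere_convergentP => z; under eq_fun do rewrite mulrDl.
exact: abs_nullD.
Qed.

Lemma tau_evalD f g z : conv f -> conv g ->
  eval (fun n => f n + g n) z = eval f z + eval g z.
Proof.
move=> f_conv g_conv; apply: tau_eval_eq; under eq_fun do rewrite mulrDl.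
by apply: abs_sumD => //; apply: tau_evalP.
Qed.

Lemma tau_adjointD f g : adj (fun n => f n + g n) = (fun n => adj f n + adj g n).
Proof. by apply/funext => n; rewrite /tau_adjoint frobzD. Qed.

(** * Right division by [1 - tau] *)

Lemma tau_comp_const f a n : (f \oT tau_const a) n = f n * phi n a.
Proof.
apply: tau_comp_eq.
have -> : f n * phi n a = \sum_(i <- [:: n]) f i * phi i (tau_const a (n - i)).
  by rewrite big_seq1 /tau_const subrr eqxx.
apply: abs_sum_finite => // i; rewrite inE => i_neq.
by rewrite /tau_const subr_eq0 eq_sym (negPf i_neq) frobz0 // mulr0.
Qed.

Lemma tau_comp_one_sub_tau f n : (f \oT one_sub_tau C) n = f n - f (n - 1).
Proof.
apply: tau_comp_eq.
have -> : f n - f (n - 1) =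
    \sum_(i <- [:: n; n - 1]) f i * phi i (one_sub_tau C (n - i)).
  rewrite big_cons big_seq1 /one_sub_tau /tau_const /tau subrr subKr /=.
  by rewrite subr0 sub0r frobzN // !frobz1 // mulr1 mulrN1.
apply: abs_sum_finite => // [|i]; first by rewrite /= inE andbT; lia.
rewrite !inE negb_or => /andP[i_neq i_neq1]; rewrite /one_sub_tau /tau_const /tau.
rewrite ifF ?ifF ?subr0 ?frobz0 ?mulr0 //; lia.
Qed.

Lemma tau_comp_const_convergent f a : conv f -> conv (f \oT tau_const a).
Proof.
move=> /everywhere_convergentP f_conv; apply/everywhere_convergentP => z.
apply: abs_null_le (f_conv (a * z)) => n.
by rewrite tau_comp_const -mulrA frobzM.
Qed.

Lemma tau_eval_comp_const f a : conv f -> eval (f \oT tau_const a) 1 = eval f a.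
Proof.
move=> f_conv; apply: tau_eval_eq; have := tau_evalP a f_conv.
congr (abs_sum v _ _); apply/funext => n.
by rewrite tau_comp_const frobz1 // mulr1.
Qed.

(** The coefficients of [g - g'] satisfy [d n = d (n - 1)], so they are all equal; as they also tend
    to 0, they vanish. *)
Lemma tau_quotient_unique g g' : conv g -> conv g' ->
  g \oT one_sub_tau C = g' \oT one_sub_tau C -> g = g'.
Proof.
move=> /everywhere_convergent_null g_null /everywhere_convergent_null g'_null gg'.
pose d n := g n - g' n.
have d_step n : d n = d (n - 1).
  have := congr1 (@^~ n) gg'; rewrite !tau_comp_one_sub_tau => /eqP.
  rewrite subr_eq => /eqP; rewrite /d => ->; ring.
have d_shift n (k : nat) : d (n - k%:Z) = d n.
  by elim: k => [|k <-]; rewrite ?subr0 // [RHS]d_step; congr d; lia.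
have d_const n : d n = d 0.
  case: n => k; first by rewrite -(d_shift k%:Z k) subrr.
  by rewrite NegzE -sub0r d_shift.
have d_null : abs_null v d.
  apply: abs_nullD => // eps /g'_null[A A_tail]; exists A => n /A_tail.
  by rewrite (nonarch_absN v_abs).
apply/funext => n; apply/eqP; rewrite -subr_eq0 -/(d n) d_const; apply/eqP.
apply: (nonarch_abs_small_eq0 v_abs) => eps /d_null[A A_tail].
have [N N_sub] := int_box_exhaust A.
rewrite -(d_const N%:Z); apply: A_tail.
by apply: contra (N_sub _ _ (leqnn N) (leqnn N) _) _; rewrite mem_int_boxP ltnn.
Qed.

(* The equation reads g_n - g_(n-1) = k_n, so that g_n is the sum of the k_i
   with i <= n, and as k(1) = 0 also minus the sum of those with n < i.  The
   first expression controls g_n for n -> -oo, the second for n -> +oo. *)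
Lemma tau_quotient_exists k : conv k -> eval k 1 = 0 ->
  exists2 g, conv g & k = g \oT one_sub_tau C.
Proof.
move=> k_conv k1; have k_null := everywhere_convergent_null k_conv.
pose low n i := if i <= n then k i else 0.
pose high n i := if i <= n then 0 else k i.
have low_sum n : exists s, abs_sum v (low n) s.
  apply: abs_null_summable => //; apply: abs_null_le k_null => i; rewrite /low.
  by case: ifP => // _; rewrite nonarch_abs0 ?(nonarch_abs_ge0 v_abs).
have [g g_low] := choice low_sum.
have k_sum : abs_sum v k 0.
  rewrite -k1; have := tau_evalP 1 k_conv; congr (abs_sum v _ _).
  by apply/funext => n; rewrite frobz1 // mulr1.
have g_high n : abs_sum v (high n) (- g n).
  have := abs_sumD v_abs k_sum (abs_sum_scale (- 1) (g_low n)).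
  rewrite add0r mulN1r; congr (abs_sum v _ _); apply/funext => i.
  by rewrite /high /low; case: ifP => _; rewrite mulN1r ?subrr ?oppr0 ?addr0.
exists g; last first.
  apply/funext => n; rewrite tau_comp_one_sub_tau.
  have := abs_sumD v_abs (g_low n) (abs_sum_scale (- 1) (g_low (n - 1))).
  rewrite mulN1r => diff_sum; apply/esym/(abs_sum_unique v_abs diff_sum).
  have low_supp i : i \notin [:: n] -> low n i + - 1 * low (n - 1) i = 0.
    rewrite inE /low mulN1r => i_neq; have -> : (i <= n - 1) = (i <= n) by lia.
    by rewrite subrr.
  have := abs_sum_finite v_abs (isT : uniq [:: n]) low_supp.
  by rewrite big_seq1 /low lexx ifF ?mulr0 ?addr0 //; lia.
apply/everywhere_convergentP => z eps eps_gt0.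
(* Replacing [z] by some [c] with [v c >= 1] makes [v (phi n c)] nondecreasing in [n]. For [n >= 0]
   it is at most [v (phi i c)] when [n < i], and [A] controls the tail; for [n < 0] it is at most
   [v c], and [B] does. *)
have [c [c_ge1 z_le]] : exists c, 1 <= v c /\ v z <= v c.
  have [z_ge1|/ltW z_le1] := leP 1 (v z); first by exists z.
  by exists 1; rewrite nonarch_abs1.
move: k_conv => /everywhere_convergentP/(_ c)/(_ eps eps_gt0)[A A_tail].
have [B B_tail] := abs_null_scale v_abs c k_null eps_gt0.
have [N N_sub] := int_box_exhaust (A ++ B).
exists (int_box N N) => n n_box; rewrite mulrC.
have tail i : i \notin int_box N N ->
    v (k i * phi i c) < eps /\ v (c * k i) < eps.
  move=> i_box; have : i \notin A ++ B.
    by apply: contra i_box; apply: N_sub.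
  by rewrite mem_cat negb_or => /andP[/A_tail ? /B_tail].
have phi_z m : v (phi n z * k m) <= v (k m * phi n c).
  rewrite mulrC !(nonarch_absM v_abs (k m)); apply: ler_wpM2l.
    exact: nonarch_abs_ge0.
  by rewrite frobz_abs_le.
have zero_lt : v (phi n z * 0) < eps by rewrite mulr0 nonarch_abs0.
case: n n_box phi_z zero_lt => n n_box phi_z zero_lt.
  rewrite -(nonarch_absN v_abs) -mulrN.
  apply: (abs_sum_lt v_abs (abs_sum_scale _ (g_high n)) eps_gt0) => i; rewrite /high.
  case: (leP i) => // ni; apply: le_lt_trans (phi_z i) _.
  have /tail[k_lt _] : i \notin int_box N N.
    by case: i ni => i ni; move: n_box; rewrite ?mem_int_boxP ?mem_int_boxN; lia.
  apply: le_lt_trans k_lt; rewrite !(nonarch_absM v_abs (k i)).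
  apply: ler_wpM2l; rewrite ?(nonarch_abs_ge0 v_abs) //.
  by rewrite frobz_abs_ge1_homo // ltW.
apply: (abs_sum_lt v_abs (abs_sum_scale _ (g_low (Negz n))) eps_gt0) => i.
rewrite /low; case: (leP i) => // ni; apply: le_lt_trans (phi_z i) _.
have /tail[_ k_lt] : i \notin int_box N N.
  by case: i ni => i ni; move: n_box; rewrite ?mem_int_boxP ?mem_int_boxN; lia.
apply: le_lt_trans k_lt; rewrite (mulrC c) !(nonarch_absM v_abs (k i)).
apply: ler_wpM2l; rewrite ?(nonarch_abs_ge0 v_abs) // -[in leRHS](frobz_id q c).
exact: frobz_abs_ge1_homo.
Qed.

(** Uniqueness forces the choice of [xget]. *)
Lemma tau_quotient_eq f alpha g : conv g ->
  f \oT tau_const alpha = g \oT one_sub_tau C -> tau_quotient v q f alpha = g.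
Proof.
move=> g_conv fg; apply: xget_unique; first by [].
by move=> g' [g'_conv fg']; apply: tau_quotient_unique => //; rewrite -fg'.
Qed.

(** The series [f o alpha] takes the value [f(alpha) = 0] at 1, which is the condition for
    divisibility by [1 - tau]. *)
Lemma tau_quotientP f alpha : conv f -> tau_ker v q f alpha ->
  conv (tau_quotient v q f alpha) /\
  f \oT tau_const alpha = tau_quotient v q f alpha \oT one_sub_tau C.
Proof.
move=> f_conv f_alpha.
have [||g g_conv fg] := @tau_quotient_exists (f \oT tau_const alpha).
- exact: tau_comp_const_convergent.
- by rewrite tau_eval_comp_const.
by rewrite (tau_quotient_eq g_conv fg).
Qed.

(** * Distributivity, associativity and the two pairing formulas *)

Lemma tau_compDr f g h n : conv f -> conv g -> conv h ->
  (f \oT (fun m => g m + h m)) n = (f \oT g) n + (f \oT h) n.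
Proof.
move=> f_conv g_conv h_conv; apply: tau_comp_eq.
have := abs_sumD v_abs (tau_compP n f_conv g_conv) (tau_compP n f_conv h_conv).
by congr (abs_sum v _ _); apply/funext => i; rewrite frobzD // mulrDr.
Qed.

(** As [tau_const a] is concentrated in degree 0, both sides come from the coefficient series of
    [f o g] in degree [n], scaled by [a^(q^n)]. *)
Lemma tau_comp_constA f g a : conv f -> conv g ->
  f \oT (g \oT tau_const a) = (f \oT g) \oT tau_const a.
Proof.
move=> f_conv g_conv; apply/funext => n.
rewrite tau_comp_const; apply: tau_comp_eq.
have := abs_sum_scale (phi n a) (tau_compP n f_conv g_conv).
rewrite mulrC; congr (abs_sum v _ _); apply/funext => i.
rewrite tau_comp_const frobzM // frobz_comp // (addrC i) subrK; ring.
Qed.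

Lemma tau_comp_one_sub_tauA f g : conv f -> conv g ->
  f \oT (g \oT one_sub_tau C) = (f \oT g) \oT one_sub_tau C.
Proof.
move=> f_conv g_conv; apply/funext => n.
rewrite tau_comp_one_sub_tau; apply: tau_comp_eq.
have := abs_sumD v_abs (tau_compP n f_conv g_conv)
  (abs_sum_scale (- 1) (tau_compP (n - 1) f_conv g_conv)).
rewrite mulN1r; congr (abs_sum v _ _); apply/funext => i.
rewrite tau_comp_one_sub_tau frobzD // frobzN //.
by rewrite (_ : n - 1 - i = n - i - 1); ring.
Qed.

Lemma tau_const_convergent a : conv (tau_const a).
Proof.
apply/everywhere_convergentP => z eps eps_gt0; exists [:: 0] => n.
by rewrite inE /tau_const => /negPf ->; rewrite mul0r nonarch_abs0.
Qed.

Lemma tau_eval_const a z : eval (tau_const a) z = a * z.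
Proof.
apply: tau_eval_eq.
have -> : a * z = \sum_(n <- [:: 0]) tau_const a n * phi n z.
  by rewrite big_seq1 /tau_const eqxx frobz_id.
apply: abs_sum_finite => // n; rewrite inE /tau_const => /negPf ->.
by rewrite mul0r.
Qed.

Lemma tau_pairing_comp_left f h alpha beta : conv f -> conv h ->
  tau_ker v q (f \oT h) alpha -> tau_ker v q (adj f) beta ->
  tau_pairing v q (f \oT h) alpha beta = tau_pairing v q f (eval h alpha) beta.
Proof.
move=> f_conv h_conv fh_alpha f_beta.
have f_halpha : tau_ker v q f (eval h alpha).
  by rewrite /tau_ker /= -tau_eval_comp.
have [g_conv fg] := tau_quotientP f_conv f_halpha.
set g := tau_quotient v q f (eval h alpha) in g_conv fg.
pose k n := (h \oT tau_const alpha) n + tau_const (- eval h alpha) n.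
have ha_conv := tau_comp_const_convergent alpha h_conv.
have k_conv : conv k := everywhere_convergentD ha_conv (tau_const_convergent _).
have [|g' g'_conv kg'] := @tau_quotient_exists k k_conv.
  rewrite tau_evalD //; last exact: tau_const_convergent.
  by rewrite tau_eval_const mulr1 tau_eval_comp_const // subrr.
have fg'_conv := tau_comp_convergent f_conv g'_conv.
have quot : tau_quotient v q (f \oT h) alpha = (fun n => g n + (f \oT g') n).
  apply: tau_quotient_eq; first exact: everywhere_convergentD.
  rewrite -tau_comp_constA //.
  (* Splitting [h o alpha] as the constant [h(alpha)] plus [k] makes [f o (h o alpha)] the sum of
     [g o (1 - tau)] and [(f o g') o (1 - tau)]. *)
  have -> : h \oT tau_const alpha = (fun n => tau_const (eval h alpha) n + k n).
    apply/funext => n; rewrite /k /tau_const; case: eqP => _; ring.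
  apply/funext => n; rewrite tau_compDr //; last exact: tau_const_convergent.
  rewrite fg kg' tau_comp_one_sub_tauA // !tau_comp_one_sub_tau; ring.
rewrite /tau_pairing quot -/g tau_adjointD tau_evalD;
  try exact: tau_adjoint_convergent.
rewrite tau_adjoint_comp // tau_eval_comp; try exact: tau_adjoint_convergent.
by rewrite (f_beta : eval _ _ = 0) tau_eval0 addr0.
Qed.

Lemma tau_pairing_comp_right f h alpha beta : conv f -> conv h ->
  tau_ker v q f alpha ->
  tau_pairing v q (h \oT f) alpha beta =
  tau_pairing v q f alpha (eval (adj h) beta).
Proof.
move=> f_conv h_conv /(tau_quotientP f_conv)[g_conv fg].
rewrite /tau_pairing; set g := tau_quotient v q f alpha in g_conv fg *.
rewrite (@tau_quotient_eq (h \oT f) alpha (h \oT g)).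
- by rewrite tau_adjoint_comp // tau_eval_comp //; apply: tau_adjoint_convergent.
- exact: tau_comp_convergent.
by rewrite -tau_comp_constA // fg tau_comp_one_sub_tauA.
Qed.

End TauSeriesRing.

Theorem proposition8p7 (p e q : nat) (p_prime : prime p) (e_gt0 : (0 < e)%N)
    (q_def : q = (p ^ e)%N)
    (Fq : finFieldType) (card_Fq : #|Fq| = q)
    (R : realType) (C : closedFieldType) (iota : {rmorphism Fq -> C})
    (v : C -> R) (v_abs : nonarch_abs v) (v_complete : abs_complete v)
    (f h : tau_series C)
    (f_conv : everywhere_convergent v q f) (f_neq0 : f <> (fun=> 0))
    (h_conv : everywhere_convergent v q h) (h_neq0 : h <> (fun=> 0)) :
  (tau_ker v q (tau_adjoint q f) `<=` tau_ker v q (tau_adjoint q (tau_comp v q f h)) /\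
   forall alpha beta : C,
     tau_ker v q (tau_comp v q f h) alpha -> tau_ker v q (tau_adjoint q f) beta ->
     tau_pairing v q (tau_comp v q f h) alpha beta =
     tau_pairing v q f (tau_eval v q h alpha) beta) /\
  (tau_ker v q f `<=` tau_ker v q (tau_comp v q h f) /\
   forall alpha beta : C,
     tau_ker v q f alpha -> tau_ker v q (tau_adjoint q (tau_comp v q h f)) beta ->
     tau_pairing v q (tau_comp v q h f) alpha beta =
     tau_pairing v q f alpha (tau_eval v q (tau_adjoint q h) beta)).
Proof.
(* [Fq] has [p^e] elements, hence characteristic [p], which [iota] carries over to [C]; and [p] is
   the only prime factor of [q]. *)
have q_pchar : [pchar C].-nat q.
  rewrite q_def in card_Fq *; rewrite pnatX; apply/orP; left.
  apply/pnatP; first exact: prime_gt0.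
  move=> r r_prime; rewrite dvdn_prime2 // => /eqP ->.
  by rewrite (fmorph_pchar iota); apply: card_finPcharP card_Fq p_prime.
have f_adj := tau_adjoint_convergent v_abs v_complete q_pchar f_conv.
have h_adj := tau_adjoint_convergent v_abs v_complete q_pchar h_conv.
split; split.
- move=> beta f_beta; rewrite /tau_ker /=.
  rewrite (tau_adjoint_comp v_abs v_complete q_pchar) //.
  rewrite (tau_eval_comp v_abs v_complete q_pchar) //.
  by rewrite (f_beta : tau_eval _ _ _ _ = 0) (tau_eval0 v_abs).
- by move=> alpha beta; apply: tau_pairing_comp_left.
- move=> alpha f_alpha; rewrite /tau_ker /=.
  rewrite (tau_eval_comp v_abs v_complete q_pchar) //.
  by rewrite (f_alpha : tau_eval _ _ _ _ = 0) (tau_eval0 v_abs).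
- by move=> alpha beta f_alpha _; apply: tau_pairing_comp_right.
Qed.
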